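(* Let $\langle\mathcal N,\varepsilon\rangle$ be the space of irrational numbers with the Euclidean topology. If CH holds, then there is a 0-dimensional first countable standard refinement $\tau$ of $\varepsilon$ on $\mathcal N$ such that (i) $R(\langle\mathcal N,\tau\rangle)=\omega$, (ii) $nw(\langle\mathcal N,\tau\rangle)=2^{\omega}$, (iii) $\langle\mathcal N,\tau\rangle$ has an irreducible base.
   Context: For $x\in\mathcal N$ and $\eta>0$ write $U(x,\eta)=(x-\eta,x+\eta)\cap\mathcal N$. For $Y\subset\mathcal N$, a topological space $\langle Y,\tau\rangle$ is a standard refinement of $\langle Y,\varepsilon\rangle$ if for each $y\in Y$ one can choose a sequence of pairwise disjoint intervals with rational endpoints, $\mathcal I^y=\{I^y_n:n\in\omega\}$, which converges to $y$, such that, putting $J^y=\bigcup\mathcal I^y$, the family $\{(U(y,\eta)\setminus J^y)\cap Y:\eta>0\}$ is a neighbourhood base of $y$ in $\tau$. A space $Z$ is weakly separated if one can assign to each $z\in Z$ an open neighbourhood $f(z)$ such that for all $y\ne z$ in $Z$, $y\notin f(z)$ or $z\notin f(y)$. $R(X)=\sup\{|Z|: Z\subset X\text{ is weakly separated}\}$. $nw$ denotes net weight. A base $\mathcal U$ (of open sets) of a space $X$ is irreducible if it can be written $\mathcal U=\bigcup\{\mathcal U_x:x\in X\}$ where (1) $\mathcal U_x$ is a neighbourhood base of $x$ in $X$ for each $x\in X$; and (2) for each $x\in X$ the family $\bigcup_{y\ne x}\mathcal U_y$ is not a base of $X$. *)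

(* Defs.v *)
From HB Require Import structures.
From mathcomp Require Import all_boot all_order all_algebra.
From mathcomp Require Import all_classical all_reals all_analysis.

Set Implicit Arguments.
Unset Strict Implicit.
Unset Printing Implicit Defensive.

Import Order.TTheory GRing.Theory Num.Theory.
Import numFieldNormedType.Exports.

Local Open Scope classical_set_scope.
Local Open Scope ring_scope.
Local Open Scope card_scope.

(* Cardinals are represented by sets up to #=: omega by [set: nat] and 2^omega
   by [set: set nat]. *)
Definition continuum_hypothesis : Prop :=
  forall A : set (set nat), countable A \/ A #= [set: set nat].

(* |K| = sup {|Z| : Z in F} *)
Definition is_card_sup (T U : Type) (F : set (set T)) (K : set U) : Prop :=
  (forall Z, F Z -> Z #<= K) /\
  (forall (V : Type) (L : set V), (forall Z, F Z -> Z #<= L) -> K #<= L).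

Section TopologicalNotions.
Context {X : topologicalType}.

Definition nbhs_base (x : X) (B : set (set X)) : Prop :=
  B `<=` nbhs x /\ filter_from B id --> x.

Definition network (N : set (set X)) : Prop :=
  forall x : X, filter_from [set A | N A /\ A x] id --> x.

Definition irreducible_base (B : set (set X)) : Prop :=
  basis B /\
  exists Bx : X -> set (set X),
    [/\ B = \bigcup_(x in [set: X]) Bx x,
        forall x, nbhs_base x (Bx x) &
        forall x, ~ basis (\bigcup_(y in [set~ x]) Bx y)].

End TopologicalNotions.

(* The library's zero_dimensional only separates points by clopen sets, which
   is weaker than having a base of clopen sets. *)
Definition clopen_based (X : topologicalType) : Prop :=
  exists2 B : set (set X), B `<=` clopen & basis B.

Definition first_countable (X : topologicalType) : Prop :=
  forall x : X, exists2 B : set (set X), countable B & nbhs_base x B.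

Definition weakly_separated (Z : topologicalType) : Prop :=
  exists f : Z -> set Z,
    (forall z, open_nbhs z (f z)) /\
    (forall y z, y <> z -> ~ f z y \/ ~ f y z).

(* R(X) = |K|; each subset Z of X carries the subspace topology *)
Definition is_R (X : topologicalType) (U : Type) (K : set U) : Prop :=
  is_card_sup [set Z : set X | weakly_separated (set_type Z)] K.

(* nw(X) = |K|, the least cardinality of a network *)
Definition is_nw (X : topologicalType) (U : Type) (K : set U) : Prop :=
  (exists2 N : set (set X), network N & N #= K) /\
  (forall N : set (set X), network N -> K #<= N).

Section StandardRefinement.
Context {R : realType}.

Definition Unbhd (x eta : R) : set R :=
  `]x - eta, x + eta[%classic `&` irrational.

Definition rat_itv (a b : rat) : set R := `]ratr a, ratr b[%classic.

(* The traces on the irrationals do not depend on whether the rational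
   endpoints are included, so the intervals are taken open; they are
   nondegenerate.  Pulling back along set_val : Y -> R is intersecting with Y.
   The topology of the last clause is given explicitly, since set_type Y has
   the Euclidean subspace topology as its canonical one. *)
Definition standard_refinement (Y : set R) (tau : Topological (set_type Y))
    : Prop :=
  forall y : Topological.Pack tau, exists a b : nat -> rat,
    let I n := rat_itv (a n) (b n) in
    let J := \bigcup_n I n in
    [/\ forall n, a n < b n,
        trivIset [set: nat] I,
        forall eta : R, 0 < eta ->
          \forall n \near \oo,
            I n `<=` `]set_val y - eta, set_val y + eta[%classic &
        @nbhs_base (Topological.Pack tau) y
          [set (set_val : Y -> R) @^-1` (Unbhd (set_val y) eta `\` J)
            | eta in [set eta : R | 0 < eta]]].

End StandardRefinement.

(* Main.v *)
(* Every standard refinement is 0-dimensional and first countable, and the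
   basic neighbourhoods always form an irreducible base. For (i) and (ii), all
   intervals of J^y are placed to the right of y. CH provides an ordering of
   type omega_1 in which, when J^y is chosen, only countably many countable sets
   D have been listed; J^y is made both to meet D and to miss points of D
   arbitrarily close to y on the right, whenever y is a right limit of D. Passing
   to countable dense subsets, for every set A of reals, all but countably many
   y in A have A split in this way by J^y. A countable network N would give, for
   each y, some A in N with y in A and A disjoint from J^y, which is possible for
   only countably many y. If Z is weakly separated by neighbourhoods of fixed size
   eta, then y < z < y + eta in Z implies z in J^y, since J^z does not contain y;
   so no y in Z is a point where J^y omits nearby points of Z to its right, and Z
   is countable. *)
Require Import Defs.
From HB Require Import structures.
From mathcomp Require Import all_boot all_order all_algebra.
From mathcomp Require Import all_classical all_reals all_analysis.
From mathcomp Require Import wochoice lra.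

Set Implicit Arguments.
Unset Strict Implicit.
Unset Printing Implicit Defensive.

Import Order.TTheory GRing.Theory Num.Theory.
Import numFieldNormedType.Exports.

(** * Countable sets, and an ordering of type $\omega_1$ under CH *)

Section Countability.
Local Open Scope classical_set_scope.
Local Open Scope card_scope.

Lemma countable_sub (T : Type) (A B : set T) :
  A `<=` B -> countable B -> countable A.
Proof. by move=> /subset_card_le; exact: sub_countable. Qed.

Lemma countableU (T : Type) (A B : set T) :
  countable A -> countable B -> countable (A `|` B).
Proof.
move=> cA cB; apply: (@countable_sub _ _ (\bigcup_b (if b then A else B))).
  by move=> x [Ax|Bx]; [exists true|exists false].
by apply: bigcup_countable => // -[].
Qed.

Lemma countable_preimage (T U : Type) (h : T -> U) (B : set U) :
  injective h -> countable B -> countable (h @^-1` B).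
Proof.
move=> hI /countable_injP[f fI]; apply/countable_injP.
exists (f \o h) => x y; rewrite !inE /= => Bx By E.
by apply: hI; apply: fI; rewrite ?inE.
Qed.

Lemma countable_sub_range (T : Type) (t0 : T) (A : set T) :
  countable A -> exists e : nat -> T, A `<=` range e.
Proof.
move=> /countable_injP[f fI].
have /choice[e eP] : forall n, exists u, forall t, A t -> f t = n -> u = t.
  move=> n; have [[t At ft]|no] := pselect (exists2 t, A t & f t = n).
    by exists t => u Au fu; apply: fI; rewrite ?inE// ft fu.
  by exists t0 => t At ft; case: no; exists t.
by exists e => t At; exists (f t) => //; exact: eP.
Qed.

Lemma CH_uncountable (T : Type) (A : set T) : continuum_hypothesis ->
  A #<= [set: set nat] -> ~ countable A -> A #= [set: set nat].
Proof.
move=> CH /card_subP[B AB _] nA.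
have [cB|BT] := CH B; last exact: card_eq_trans (card_esym AB) BT.
by case: nA; rewrite -(eq_countable AB).
Qed.

(** What the diagonalisation takes from an ordering of type $\omega_1$: each stage has only
    countably many predecessors to treat, and each object is treated at all but countably many
    stages. *)
Definition omega1_like (T : Type) (prec : T -> T -> Prop) : Prop :=
  (forall y, countable [set x | prec x y]) /\
  (forall x, countable [set y | ~ prec x y]).

(** Well-order [set nat]. If some initial segment is uncountable, let [y] be the least point
    bounding one; by CH the points strictly below [y] are in bijection with [set nat], and the order
    is pulled back along this bijection [h]. *)
Lemma CH_omega1_like : continuum_hypothesis ->
  exists prec : set nat -> set nat -> Prop, omega1_like prec.
Proof.
move=> CH; have [le le_wo] := well_ordering_principle (set nat).
have min_ex (P : set nat -> Prop) : (exists x, P x) ->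
    exists2 z, P z & forall x, P x -> le z x.
  move=> [x Px]; have [|z [[Pz minz] _]] := le_wo (fun v => `[< P v >]).
    by exists x; apply/asboolP.
  by exists z => [|y Py]; [exact/asboolP|apply: minz; apply/asboolP].
have le_tot x y : le x y \/ le y x.
  have [|z [->|->] zP] := min_ex (fun u => u = x \/ u = y); first by exists x; left.
    by left; apply: zP; right.
  by right; apply: zP; left.
suff [h hI hP] : exists2 h : set nat -> set nat, injective h &
    forall v, countable [set u | le (h u) (h v)].
  exists (fun u v => le (h u) (h v) /\ h u <> h v); split => [v|u].
    by apply: countable_sub (hP v) => u [].
  apply: countable_sub (hP u) => v /= /not_andP[nle|/contrapT <-].
    by have [|] := le_tot (h v) (h u).
  by have [|] := le_tot (h u) (h u).
have [all_ctb|] := pselect (forall v, countable [set u | le u v]); first by exists id.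
move=> /existsNP/min_ex[y ny miny].
pose S := [set x | le x y /\ x <> y].
have [cS|SE] := CH S.
  case: ny; apply: countable_sub (countableU cS (countable1 y)) => x /= xy.
  by have [->|] := pselect (x = y); [right|left].
move: SE; rewrite card_eq_sym => /card_set_bijP[h [hS hI _]].
have {}hI : injective h by move=> u v; apply: hI; rewrite inE.
exists h => // v; apply: (@countable_preimage _ _ h [set x | le x (h v)]) => //.
apply: contrapT => /miny yhv; have [hvy hv_ne] := hS v I.
(* Antisymmetry comes from the uniqueness of least elements: [y] and [h v] would both be least in
   $\{y, h v\}$. *)
have [|z [_ zuniq]] := le_wo (fun u => `[< u = y \/ u = h v >]).
  by exists y; apply/asboolP; left.
have le_refl u : le u u by have [|] := le_tot u u.
apply: hv_ne; rewrite -(zuniq y); last first.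
  by split=> [|u /asboolP[->|->]//]; apply/asboolP; left.
apply/esym/zuniq; split=> [|u /asboolP[->|->]//]; by apply/asboolP; right.
Qed.

End Countability.

(** * Right limit points of sets of reals *)

Section RightAccumulation.
Local Open Scope classical_set_scope.
Local Open Scope ring_scope.
Context {R : realType}.
Implicit Types (x y : R) (D A : set R).

Definition right_limit D y : Prop :=
  forall u, y < u -> exists2 d, D d & y < d < u.

Lemma rat_between x y : x < y -> exists q : rat, x < ratr q < y.
Proof. by move=> /rat_in_itvoo[q]; rewrite in_itv /= => ?; exists q. Qed.

(** Attach to each such [y] a rational [q] with no point of [A] in $(y,q)$. Two points $x<y$ of the
    set cannot share [q], since [y] would lie in $(x,q)$. *)
Lemma countable_no_right_limit A : countable [set y | A y /\ ~ right_limit A y].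
Proof.
have /choice[q qP] : forall y, exists q : rat, ~ right_limit A y ->
    y < ratr q /\ forall d, A d -> ~ y < d < ratr q.
  move=> y; have [//|/existsNP[u /not_implyP[yu nd]]] := pselect (right_limit A y).
    by move=> Ay; exists 0.
  have [r /andP[yr ru]] := rat_between yu.
  exists r => _; split => // d Ad /andP[yd dr].
  by apply: nd; exists d; rewrite // yd (lt_trans dr).
apply/countable_injP; exists (pickle \o q) => x y.
rewrite !inE /= => -[Ax /qP[xq xP]] [Ay /qP[yq yP]] /(pcan_inj pickleK) qE.
apply/eqP; rewrite eq_le !leNgt; apply/andP; split; apply/negP => lt.
  by apply: (yP x Ax); rewrite lt -qE.
by apply: (xP y Ay); rewrite lt qE.
Qed.

(** Pick a point of [A] in every rational interval that meets [A]; every right limit of [A] is then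
    a right limit of the picked points. *)
Lemma right_dense_sequence A : A !=set0 -> exists2 s : nat -> R,
  (forall m, A (s m)) & countable [set y | A y /\ ~ right_limit (range s) y].
Proof.
move=> [a0 Aa0].
have /choice[c cP] : forall pq : rat * rat, exists c, A c /\
    ((exists2 d, A d & ratr pq.1 < d < ratr pq.2) -> ratr pq.1 < c < ratr pq.2).
  move=> pq; have [[d Ad dpq]|no] := pselect (exists2 d, A d & ratr pq.1 < d < ratr pq.2).
    by exists d.
  by exists a0.
(* The default pair at numbers coding no pair is harmless, as all values of [c] lie in [A]. *)
exists (fun n => c (odflt (0, 0) (unpickle n))) => [m|]; 
  first by have [] := cP (odflt (0, 0) (unpickle m)).
apply: countable_sub (countable_no_right_limit A) => y [Ay nlim]; split=> // lim.
apply: nlim => u yu; have [d Ad /andP[yd du]] := lim u yu.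
have [p /andP[yp pd]] := rat_between yd; have [q /andP[dq qu]] := rat_between du.
have [_ /(_ _)/andP[|pc cq]] := cP (p, q); first by exists d; rewrite //= pd.
exists (c (p, q)); last by rewrite (lt_trans yp)//= (lt_trans cq).
by exists (pickle (p, q)); rewrite ?pickleK.
Qed.

End RightAccumulation.

(** * The gaps $J^y$ and their construction by diagonalisation *)

Section Gaps.
Local Open Scope classical_set_scope.
Local Open Scope ring_scope.

(* The intervals [I^y_n = (lo y n, hi y n)] lie to the right of [y], so that
   [z \in J^y] forces [y < z]. *)
Record gaps (R : realType) := Gaps {
  lo : R -> nat -> rat;
  hi : R -> nat -> rat;
  lo_gt : forall y n, y < ratr (lo y n);
  lo_lt_hi : forall y n, lo y n < hi y n;
  hi_lt_lo : forall y n, hi y n.+1 < lo y n;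
  hi_lt : forall y n, ratr (hi y n) < y + n.+1%:R^-1
}.

Context {R : realType}.
Implicit Types (G : gaps R) (y z : R).

(** This is $J^y$. *)
Definition gap G y : set R := \bigcup_n rat_itv (lo G y n) (hi G y n).

Lemma rat_itvE (a b : rat) (x : R) : rat_itv a b x = (ratr a < x < ratr b) :> Prop.
Proof. by rewrite /rat_itv /= in_itv. Qed.

Lemma gapP G y z :
  gap G y z <-> exists n, ratr (lo G y n) < z < ratr (hi G y n).
Proof.
by split=> [[n _]|[n zn]]; [rewrite rat_itvE => zn; exists n|exists n => //; rewrite rat_itvE].
Qed.

Lemma gap_gt G y z : gap G y z -> y < z.
Proof. by move=> /gapP[n /andP[+ _]]; exact: lt_trans (lo_gt G y n). Qed.

Lemma hi_lt_lo_lt G y m n : (m < n)%N -> hi G y n < lo G y m.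
Proof.
elim: n => // n IH; rewrite ltnS leq_eqVlt => /predU1P[->|mn]; first exact: hi_lt_lo.
exact: lt_trans (hi_lt_lo G y n) (lt_trans (lo_lt_hi G y n) (IH mn)).
Qed.

Lemma notin_gap G y n z :
  ratr (hi G y n.+1) < z < ratr (lo G y n) -> ~ gap G y z.
Proof.
move=> /andP[hz zl] /gapP[m /andP[lz zh]].
have [mn|nm] := leqP m n.
  have : ratr (lo G y n) <= ratr (lo G y m) :> R.
    rewrite ler_rat; move: mn; rewrite leq_eqVlt => /predU1P[->//|mn].
    exact: ltW (lt_trans (lo_lt_hi G y n) (hi_lt_lo_lt G y mn)).
  by rewrite leNgt (lt_trans lz).
have : ratr (hi G y m) <= ratr (hi G y n.+1) :> R.
  rewrite ler_rat; move: nm; rewrite leq_eqVlt => /predU1P[->//|nm].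
  exact: ltW (lt_trans (hi_lt_lo_lt G y nm) (lo_lt_hi G y n.+1)).
by rewrite leNgt (lt_trans hz).
Qed.

Lemma gap_trivIset G y :
  trivIset [set: nat] (fun n => rat_itv (lo G y n) (hi G y n) : set R).
Proof.
apply: ltn_trivIset => n m nm; rewrite -subset0 => z [].
rewrite !rat_itvE => /andP[lz _] /andP[_ zh].
by have := lt_trans lz zh; rewrite ltr_rat ltNge ltW ?hi_lt_lo_lt.
Qed.

(** The first half is used against countable networks, the second against uncountable weakly
    separated sets. *)
Definition splits_at G y (A : set R) : Prop :=
  A `&` gap G y !=set0 /\
  forall u, y < u -> exists2 d, A d & y < d < u /\ ~ gap G y d.

Definition generic G : Prop :=
  forall A : set R, countable [set y | A y /\ ~ splits_at G y A].

(** At a right limit, take [d] in [D] close to [y], then [d'] in [D] between [y] and [d], and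
    rationals with $r'<d'<a<d<b<r$. The interval $(a,b)$ catches [d], while [d'] stays free once the
    next interval is built below [r']. *)
Lemma gap_step (D : set R) y (r : rat) (n : nat) : y < ratr r ->
  exists t : rat * rat * rat, let: (a, b, r') := t in
    [/\ [/\ y < ratr r', r' < a, a < b & b < r],
        ratr b < y + n.+1%:R^-1 &
        right_limit D y ->
          (exists2 d, D d & ratr a < d < ratr b) /\
          (exists2 d, D d & ratr r' < d < ratr a)].
Proof.
move=> yr; set u := Num.min (ratr r) (y + n.+1%:R^-1).
have yu : y < u by rewrite lt_min yr ltrDl invr_gt0 ltr0n.
have [d [d' [/andP[yd' d'd] du dP]]] : exists d d', [/\ y < d' < d, d < u &
    right_limit D y -> D d /\ D d'].
  have [lim|nlim] := pselect (right_limit D y).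
    have [d Dd /andP[yd du]] := lim u yu; have [d' Dd' yd'] := lim d yd.
    by exists d, d'.
  have [d /andP[yd du]] := rat_between yu; have [d' yd'] := rat_between yd.
  by exists (ratr d), (ratr d').
have [b /andP[db]] := rat_between du; rewrite lt_min => /andP[br bn].
have [a /andP[d'a ad]] := rat_between d'd.
have [r' /andP[yr' r'd']] := rat_between yd'.
exists (a, b, r'); split => //.
  rewrite yr' -3!(ltr_rat R); split=> //; [exact: lt_trans d'a|exact: lt_trans db].
by move=> /dP[Dd Dd']; split; [exists d; rewrite // ad|exists d'; rewrite // r'd'].
Qed.

(* [logn 2] takes every value infinitely often, so each [D i] is treated at
   arbitrarily small scales. *)
Lemma gap_sequence (D : nat -> set R) y : exists a b : nat -> rat,
  [/\ forall n, y < ratr (a n), forall n, a n < b n, forall n, b n.+1 < a n,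
      forall n, ratr (b n) < y + n.+1%:R^-1 &
      forall i, right_limit (D i) y ->
        (exists n, exists2 d, D i d & ratr (a n) < d < ratr (b n)) /\
        (forall N, exists2 n, (N <= n)%N &
           exists2 d, D i d & ratr (b n.+1) < d < ratr (a n))].
Proof.
have /choice[step stepP] : forall nr : nat * rat, exists t : rat * rat * rat,
    y < ratr nr.2 -> let: (a, b, r') := t in
    [/\ [/\ y < ratr r', r' < a, a < b & b < nr.2],
        ratr b < y + nr.1.+1%:R^-1 &
        right_limit (D (logn 2 nr.1)) y ->
          (exists2 d, D (logn 2 nr.1) d & ratr a < d < ratr b) /\
          (exists2 d, D (logn 2 nr.1) d & ratr r' < d < ratr a)].
  move=> [n r]; have [yr|] := boolP (y < ratr r); last by exists (0, 0, 0).
  by have [t tP] := gap_step (D (logn 2 n)) n yr; exists t.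
have [r0 /andP[yr0 _]] : exists q : rat, y < ratr q < y + 1.
  by apply: rat_between; rewrite ltrDl.
(* [r n] bounds the n-th interval from above. Since [b n.+1 < r n.+1], a point between [r n.+1] and
   [a n] falls between consecutive intervals. *)
pose r := fix r n := if n is m.+1 then (step (m, r m)).2 else r0.
pose a n := (step (n, r n)).1.1; pose b n := (step (n, r n)).1.2.
have main n : y < ratr (r n) -> [/\ [/\ y < ratr (r n.+1), r n.+1 < a n, a n < b n & b n < r n],
        ratr (b n) < y + n.+1%:R^-1 &
        right_limit (D (logn 2 n)) y ->
          (exists2 d, D (logn 2 n) d & ratr (a n) < d < ratr (b n)) /\
          (exists2 d, D (logn 2 n) d & ratr (r n.+1) < d < ratr (a n))].
  by move=> /(stepP (n, r n)); rewrite /a /b /=; case: (step _) => -[].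
have yr n : y < ratr (r n) by elim: n => // n /main[[]].
have logE i N : logn 2 (2 ^ i * N.*2.+1) = i.
  by rewrite lognM ?expn_gt0// pfactorK// logn_coprime ?addn0// coprime2n /= odd_double.
have br n : b n < r n by have [[]] := main n (yr n).
exists a, b; split=> [n|n|n|n|i lim].
- have [[yr' r'a _ _] _ _] := main n (yr n).
  by rewrite (lt_trans yr')// ltr_rat.
- by have [[]] := main n (yr n).
- have [[_ r'a _ _] _ _] := main n (yr n).
  exact: lt_trans (br n.+1) r'a.
- by have [] := main n (yr n).
- split=> [|N].
    exists (2 ^ i * 0.*2.+1)%N; have [_ _] := main _ (yr (2 ^ i * 0.*2.+1)%N).
    by rewrite logE => /(_ lim)[].
  exists (2 ^ i * N.*2.+1)%N.
    rewrite (leq_trans _ (leq_pmull _ _)) ?expn_gt0//.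
    by rewrite -addnn (leq_trans (leq_addr N N)).
  have [_ _] := main _ (yr (2 ^ i * N.*2.+1)%N).
  rewrite logE => /(_ lim)[_ [d Dd /andP[rd da]]]; exists d => //.
  by rewrite da andbT (lt_trans _ rd)// ltr_rat.
Qed.

(** A sequence is determined by the rational lower cuts of its terms, recorded through codes of
    pairs $(i,q)$. *)
Lemma sequences_card_le : ([set: nat -> R] #<= [set: set nat])%card.
Proof.
apply/pcard_injP.
exists (fun s => [set n | exists i (q : rat), n = pickle (i, q) /\ ratr q < s i]).
move=> s t _ _ E; apply/funext => i; apply/eqP; rewrite eq_le !leNgt.
have mem (v : nat -> R) (q : rat) :
    [set n | exists i (q : rat), n = pickle (i, q) /\ ratr q < v i] (pickle (i, q)) <->
    ratr q < v i.
  by split=> [[j [p [/(pcan_inj pickleK)[-> ->]]]]//|qv]; exists i, q.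
apply/andP; split; apply/negP => /rat_between[q /andP[lq ql]].
- by have := proj2 (mem s q) ql; rewrite E => /mem; rewrite ltNge ltW.
- by have := proj2 (mem t q) ql; rewrite -E => /mem; rewrite ltNge ltW.
Qed.

(** Constant sequences embed the reals among the sequences, so one ordering compares points with
    sequences. The gap at [y] is built against all sequences preceding [y]; a set [A] is handled
    through a sequence in [A] having all but countably many points of [A] as right limits. *)
Theorem generic_gaps_exist : continuum_hypothesis -> exists G : gaps R, generic G.
Proof.
move=> CH; have [prec [prec_ctb prec_coctb]] := CH_omega1_like CH.
have /pcard_injP[code code_inj] := sequences_card_le.
have {}code_inj : injective code by move=> s t; apply: code_inj; rewrite inE.
have /choice[e eP] : forall y : R, exists e : nat -> nat -> R,
    [set s | prec (code s) (code (cst y))] `<=` range e.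
  move=> y; apply: (countable_sub_range (cst y)).
  exact: (countable_preimage code_inj (prec_ctb _)).
have /choice[ab abP] : forall y : R, exists ab : (nat -> rat) * (nat -> rat),
  [/\ forall n, y < ratr (ab.1 n), forall n, ab.1 n < ab.2 n,
      forall n, ab.2 n.+1 < ab.1 n,
      forall n, ratr (ab.2 n) < y + n.+1%:R^-1 &
      forall i, right_limit (range (e y i)) y ->
        (exists n, exists2 d, range (e y i) d & ratr (ab.1 n) < d < ratr (ab.2 n)) /\
        (forall N, exists2 n, (N <= n)%N &
           exists2 d, range (e y i) d & ratr (ab.2 n.+1) < d < ratr (ab.1 n))].
  by move=> y; have [a [b abP]] := gap_sequence (fun i => range (e y i)) y; exists (a, b).
have lo_gt y n : y < ratr ((ab y).1 n) by have [] := abP y.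
have lo_lt_hi y n : (ab y).1 n < (ab y).2 n by have [] := abP y.
have hi_lt_lo y n : (ab y).2 n.+1 < (ab y).1 n by have [] := abP y.
have hi_lt y n : ratr ((ab y).2 n) < y + n.+1%:R^-1 by have [] := abP y.
pose G := Gaps lo_gt lo_lt_hi hi_lt_lo hi_lt.
exists G => A.
have [->|/set0P A0] := eqVneq A set0.
  by apply: countable_sub (countable0 R) => y [].
have [s sA s_dense] := right_dense_sequence A0.
have cst_inj : injective (fun y : R => code (cst y)).
  by move=> x y /code_inj/(congr1 (fun f => f 0%N)).
(* Two exceptional sets are discarded: the points of [A] that are not right limits of [s], and the
   points that [s] does not precede. *)
apply: countable_sub (countableU s_dense (countable_preimage cst_inj (prec_coctb (code s)))).
move=> y [Ay nsplit].
apply: contrapT => /not_orP[/not_andP[//|/contrapT lim] /contrapT /(eP y)[i _ eE]].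
have [_ _ _ _ /(_ i)] := abP y; rewrite eE => /(_ lim)[[n [_ [m _ <-] smn]] omit].
apply: nsplit; split; first by exists (s m); split=> //; apply/gapP; exists n.
(* From index [N] on, all intervals lie below $y+1/(N+1)<u$, and so do the omitted points to their
   left. *)
move=> u yu; have [N yNu] := ltr_add_invr yu.
have [n' Nn' [_ [k _ <-] skn']] := omit N; exists (s k) => //.
split; last exact: (@notin_gap G y n').
case/andP: skn' => hs sl; apply/andP; split.
  by rewrite (lt_trans (lo_gt y n'.+1))// (lt_trans _ hs)// ltr_rat.
rewrite (lt_trans sl)// (lt_trans _ yNu)// (@lt_le_trans _ _ (y + n'.+1%:R^-1))//.
  by rewrite (lt_trans _ (hi_lt y n'))// ltr_rat.
by rewrite lerD2l lef_pV2 ?posrE ?ltr0n// ler_nat.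
Qed.
End Gaps.

(** * The refined topology and its basic neighbourhoods *)

Section Refinement.
Local Open Scope classical_set_scope.
Local Open Scope ring_scope.
Context {R : realType}.

(** The rational endpoints differ from the irrational [z], so a Euclidean neighbourhood of [z] stays
    on one side of each. *)
Lemma near_rat_itv (a b : rat) (z : R) : irrational z ->
  \forall w \near z, rat_itv a b w <-> rat_itv a b z.
Proof.
move=> irr.
have neq q : ratr q != z by apply/eqP => qz; apply: irr; exists q.
have [za|az] := ltP z (ratr a).
  near=> w; rewrite !rat_itvE.
  have wa : w < ratr a by near: w; exact: lt_nbhsl.
  by rewrite !(ltNge (ratr a)) !ltW.
have [bz|zb] := ltP (ratr b) z.
  near=> w; rewrite !rat_itvE.
  have bw : ratr b < w by near: w; exact: lt_nbhsr.
  by rewrite !(ltNge _ (ratr b)) !ltW// !andbF.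
have {}az : ratr a < z by rewrite lt_neqAle neq.
have {}zb : z < ratr b by rewrite lt_neqAle eq_sym neq.
near=> w; rewrite !rat_itvE az zb.
have -> : ratr a < w by near: w; exact: lt_nbhsr.
by have -> : w < ratr b by near: w; exact: lt_nbhsl.
Unshelve. all: by end_near. Qed.

(** No gap lies to the left of [y]. To the right, only intervals of index below [N] reach past
    $y+1/(N+1)$, so near [z] finitely many rational intervals decide membership. *)
Lemma near_gap (G : gaps R) (y z : R) : irrational z -> z <> y ->
  \forall w \near z, gap G y w <-> gap G y z.
Proof.
move=> irr /eqP; rewrite neq_lt => /orP[zy|yz].
  near=> w; have wy : w < y by near: w; exact: lt_nbhsl.
  by split=> /gap_gt; rewrite ltNge ltW.
have [N yNz] := ltr_add_invr yz.
have nearI n : \forall w \near z, forall m, (m < n)%N ->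
    rat_itv (lo G y m) (hi G y m) w <-> rat_itv (lo G y m) (hi G y m) z.
  elim: n => [|n IH]; first by near=> w => m.
  apply: filterS2 IH (near_rat_itv (lo G y n) (hi G y n) irr) => w IHw In m.
  by rewrite ltnS leq_eqVlt => /predU1P[->//|/IHw].
have far (v : R) m : y + N.+1%:R^-1 < v -> rat_itv (lo G y m) (hi G y m) v -> (m < N)%N.
  rewrite rat_itvE => yNv /andP[_ vh]; rewrite ltnNge; apply/negP => Nm.
  have := lt_trans (lt_trans yNv vh) (hi_lt G y m).
  by rewrite ltrD2l ltf_pV2 ?posrE ?ltr0n// ltr_nat ltnS ltnNge Nm.
near=> w.
have yNw : y + N.+1%:R^-1 < w by near: w; exact: lt_nbhsr.
have wz : forall m, (m < N)%N ->
    rat_itv (lo G y m) (hi G y m) w <-> rat_itv (lo G y m) (hi G y m) z.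
  by near: w; exact: nearI.
by split=> -[m _ Im]; exists m => //; apply/wz => //; exact: far Im.
Unshelve. all: by end_near. Qed.

(** A copy of the irrationals tagged by [G], so that it can carry the refined topology instead of
    the Euclidean subspace topology of [set_type]. *)
Definition refined (G : gaps R) : Type := set_type (@irrational R).

HB.instance Definition _ (G : gaps R) := Choice.on (refined G).

Variable G : gaps R.
Notation X := (refined G).
Implicit Types (x y z : X) (eta : R).

Definition pt (x : X) : R := set_val x.

Lemma pt_irr x : irrational (pt x). Proof. exact: set_valP. Qed.

Lemma pt_inj : injective pt. Proof. exact: val_inj. Qed.

Lemma exists_pt (r : R) : irrational r -> exists x, pt x = r.
Proof. by move=> irr; exists (exist _ r (mem_set irr)). Qed.

Definition basic y eta : set X :=
  pt @^-1` (Unbhd (pt y) eta `\` gap G (pt y)).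

Lemma basicP y eta z :
  basic y eta z <-> pt y - eta < pt z < pt y + eta /\ ~ gap G (pt y) (pt z).
Proof.
rewrite /basic /Unbhd /= in_itv /=; split=> [[[? _] ?]//|[? ?]]; split=> //; split=> //.
exact: pt_irr.
Qed.

Lemma basic_self y eta : 0 < eta -> basic y eta y.
Proof.
move=> eta0; apply/basicP; rewrite ltrBlDr ltrDl eta0; split=> // /gap_gt.
by rewrite ltxx.
Qed.

Lemma basic_sub y eta eta' : eta <= eta' -> basic y eta `<=` basic y eta'.
Proof.
move=> le z /basicP[/andP[h1 h2] ngap]; apply/basicP; split=> //; apply/andP; split.
  by rewrite (le_lt_trans _ h1)// lerD2l lerN2.
by rewrite (lt_le_trans h2)// lerD2l.
Qed.

Definition refined_nbhs y : set_system X :=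
  filter_from [set eta | 0 < eta] (basic y).

Lemma refined_nbhs_filter y : ProperFilter (refined_nbhs y).
Proof.
apply: filter_from_proper => [|eta /= eta0]; last by exists y; exact: basic_self.
apply: filter_from_filter => [|e1 e2 /= e10 e20]; first by exists 1 => /=.
exists (Num.min e1 e2) => /=; first by rewrite lt_min e10.
by move=> z Bz; split; apply: basic_sub Bz; rewrite ge_min lexx ?orbT.
Qed.

Lemma refined_nbhs_pt y (P : set R) : nbhs (pt y) P -> refined_nbhs y (pt @^-1` P).
Proof.
move=> /nbhs_ballP[e /= e0 eP]; exists e => //= z /basicP[yz _]; apply: eP.
by rewrite /ball /= distrC ltr_distl.
Qed.

(** This is what makes basic sets open: away from [y] membership in the gap of [y] is locally
    constant in the Euclidean sense, and the refined topology is finer. *)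
Lemma near_basic y eta z : basic y eta z -> z <> y ->
  \forall w \near pt z, pt y - eta < w < pt y + eta /\ ~ gap G (pt y) w.
Proof.
move=> /basicP[/andP[h1 h2] ngap] zy; near=> w; split.
  by apply/andP; split; near: w; [exact: lt_nbhsr|exact: lt_nbhsl].
have gw : gap G (pt y) w <-> gap G (pt y) (pt z).
  near: w; apply: near_gap; first exact: pt_irr.
  by move/pt_inj.
by move=> /gw.
Unshelve. all: by end_near. Qed.

Lemma refined_nbhs_nbhs y (A : set X) :
  refined_nbhs y A -> refined_nbhs y (refined_nbhs^~ A).
Proof.
move=> [eta /= eta0 etaA]; exists eta => //= z Bz.
have [->|zy] := pselect (z = y); first by exists eta.
have /(@refined_nbhs_pt z) := near_basic Bz zy.
by move=> [e /= e0 eP]; exists e => //= w /eP/basicP/etaA.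
Qed.

HB.instance Definition _ := hasNbhs.Build X refined_nbhs.

Lemma refined_nbhs_singleton y (A : set X) : refined_nbhs y A -> A y.
Proof. by move=> [eta /= eta0]; apply; exact: basic_self. Qed.

HB.instance Definition _ := Nbhs_isNbhsTopological.Build X
  refined_nbhs_filter refined_nbhs_singleton refined_nbhs_nbhs.

Lemma nbhs_basic y eta : 0 < eta -> nbhs y (basic y eta).
Proof. by move=> eta0; exists eta. Qed.

Lemma open_basic y eta : open (basic y eta).
Proof.
rewrite openE => z Bz; have [zy|zy] := pselect (z = y).
  subst z; apply: nbhs_basic; have /basicP[/andP[+ _] _] := Bz.
  by rewrite ltrBlDr ltrDl.
have /(@refined_nbhs_pt z) := near_basic Bz zy.
by apply: filterS => w /basicP.
Qed.

Lemma pt_continuous : continuous (pt : X -> R).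
Proof. by move=> y P; exact: refined_nbhs_pt. Qed.

Lemma refined_nbhs_base y :
  nbhs_base y [set basic y eta | eta in [set eta | 0 < eta]].
Proof.
split=> [_ [eta eta0 <-]|A [eta eta0 etaA]]; first exact: nbhs_basic.
by exists (basic y eta) => //; exists eta.
Qed.

Lemma refined_first_countable : first_countable X.
Proof.
move=> y; exists (range (fun n => basic y n.+1%:R^-1)).
  exact: sub_countable (card_image_le _ _) (countableP _).
split=> [_ [n _ <-]|A [eta eta0 etaA]]; first by apply: nbhs_basic; rewrite invr_gt0 ltr0n.
have [n neta] := ltr_add_invr eta0; exists (basic y n.+1%:R^-1); first by exists n.
apply: subset_trans etaA; apply: basic_sub; apply: ltW.
by rewrite add0r in neta.
Qed.

(** A basic set need not be closed, because $y\pm\eta$ may be irrational. With rational endpoints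
    [p], [q] instead, membership in [C] is locally constant at every point other than [y], and [y]
    is interior to [C]. *)
Lemma refined_clopen_based : clopen_based X.
Proof.
exists clopen => //; split=> [A []//|y A [eta /= eta0 etaA]].
have [p /andP[yp py]] : exists p : rat, pt y - eta < ratr p < pt y.
  by apply: rat_between; rewrite ltrBlDr ltrDl.
have [q /andP[yq qy]] : exists q : rat, pt y < ratr q < pt y + eta.
  by apply: rat_between; rewrite ltrDl.
pose C : set X := pt @^-1` (rat_itv p q `\` gap G (pt y)).
have Cy : C y.
  by split; [rewrite rat_itvE py|move=> /gap_gt; rewrite ltxx].
have CA : C `<=` basic y eta.
  move=> z []; rewrite rat_itvE => /andP[pz zq] ngap; apply/basicP; split=> //.
  by rewrite (lt_trans yp)//= (lt_trans zq).
have nearC z : z <> y -> nbhs z [set w | C w <-> C z].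
  move=> zy; have zy' : pt z <> pt y by move/pt_inj.
  have nI := refined_nbhs_pt (near_rat_itv p q (@pt_irr z)).
  have ngap := refined_nbhs_pt (near_gap G (@pt_irr z) zy').
  apply: filterS (filterI nI ngap) => w [Iw gw].
  by rewrite /C /=; split=> -[/Iw Iz nz]; split=> // /gw.
exists C; last exact: subset_trans etaA.
split=> //; split.
  rewrite openE => z Cz; have [->|zy] := pselect (z = y); last first.
    by apply: filterS (nearC z zy) => w /= ->.
  have yI : nbhs y (pt @^-1` rat_itv p q).
    apply: refined_nbhs_pt; apply: filterS (near_rat_itv p q (@pt_irr y)) => w ->.
    by rewrite rat_itvE py.
  apply: filterS (filterI yI (nbhs_basic y ltr01)).
  by move=> w [Iw /basicP[_ ngap]].
rewrite -openC openE => z nCz; have zy : z <> y by move=> zy; apply: nCz; rewrite zy.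
by apply: filterS (nearC z zy) => w /= Cw /Cw.
Qed.

End Refinement.

Arguments pt {R G}.

(** * Standardness, the irreducible base, weak separation and net weight *)

Section Invariants.
Local Open Scope classical_set_scope.
Local Open Scope ring_scope.
Context {R : realType}.

(** A countable set has Lebesgue measure zero, whereas $(a,b)$ has measure $b-a>0$. *)
Lemma exists_notin_countable (A : set R) (a b : R) : countable A -> a < b ->
  exists2 x, ~ A x & a < x < b.
Proof.
move=> cA ab; apply: contrapT => no.
have sub : `]a, b[%classic `<=` A.
  by move=> x; rewrite /= in_itv /= => xab; apply: contrapT => nAx; apply: no; exists x.
have := countable_lebesgue_measure0 (countable_sub sub cA).
rewrite lebesgue_measure_itv /= lte_fin ab -EFinD => /eqP.
by rewrite eqe subr_eq0 gt_eqF.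
Qed.

Lemma countable_rational : countable (@rational R).
Proof. exact: sub_countable (card_image_le _ _) (countableP _). Qed.

Lemma exists_irrational (a b : R) : a < b -> exists2 x, irrational x & a < x < b.
Proof. exact: exists_notin_countable countable_rational. Qed.

Lemma uncountable_irrational : ~ countable (@irrational R).
Proof.
move=> cI.
have [x nx _] := exists_notin_countable (countableU countable_rational cI) (@ltr01 R).
by apply: nx; have [|] := pselect (rational x); [left|right].
Qed.

Variable G : gaps R.
Notation X := (refined G).
Implicit Types (x y z : X) (eta : R).

Lemma refined_standard : standard_refinement (Topological.class X).
Proof.
move=> y; exists (lo G (@pt _ G y)), (hi G (@pt _ G y)); split=> [n| |eta eta0|].
- exact: lo_lt_hi.
- exact: gap_trivIset.
- have [N] := ltr_add_invr eta0; rewrite add0r => Neta.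
  exists N => // n /= Nn w; rewrite rat_itvE /= in_itv /= => /andP[lw wh].
  apply/andP; split.
    by rewrite (lt_trans _ lw)// (lt_trans _ (lo_gt G _ n))// ltrBlDr ltrDl.
  rewrite (lt_trans wh)// (lt_trans (hi_lt G _ n))// ltrD2l.
  by rewrite (le_lt_trans _ Neta)// lef_pV2 ?posrE ?ltr0n// ler_nat.
- exact: refined_nbhs_base.
Qed.

(* A basic neighbourhood of [y] is Euclidean open away from [y], so it meets
   the gap of any other point [x] it contains; hence no such neighbourhood
   fits between [x] and [basic x 1]. *)
Lemma refined_irreducible_base : exists B : set (set X), irreducible_base B.
Proof.
pose Bx (y : X) := [set basic y eta | eta in [set eta | 0 < eta]].
exists (\bigcup_(y in [set: X]) Bx y); split.
  split=> [_ [y _ [eta _ <-]]|y A [eta /= eta0 etaA]]; first exact: open_basic.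
  exists (basic y eta) => //; split; last exact: basic_self.
  by exists y => //; exists eta.
exists Bx; split=> [//|y|x [_ bas]]; first exact: refined_nbhs_base.
have [_ [[y /= yx [eta eta0 <-]] Bx0] sub] := bas x _ (nbhs_basic x ltr01).
have /nbhs_ballP[e /= e0 eP] := near_basic Bx0 (fun xy => yx (esym xy)).
have [n] := ltr_add_invr e0; rewrite add0r => ne.
have [|w irr /andP[lw wh]] := @exists_irrational (ratr (lo G (pt x) n)) (ratr (hi G (pt x) n)).
  by rewrite ltr_rat lo_lt_hi.
have [u uw] := exists_pt G irr; subst w.
have [|h ngap] := eP (pt u).
  rewrite /ball /= distrC ltr_distl; apply/andP; split.
    by rewrite (lt_trans _ lw)// (lt_trans _ (lo_gt G _ n))// ltrBlDr ltrDl.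
  by rewrite (lt_trans wh)// (lt_trans (hi_lt G _ n))// ltrD2l.
have /sub/basicP[_] : basic y eta u by apply/basicP.
by apply; apply/gapP; exists n; rewrite lw.
Qed.

Lemma countable_pt (A : set X) : countable (pt @` A) -> countable A.
Proof.
move=> cA; apply: countable_sub (countable_preimage (@pt_inj _ G) cA).
by move=> x Ax; exists x.
Qed.

Lemma weakly_separated_nbhs (Z : set X) : weakly_separated (set_type Z) ->
  exists g : X -> set X, (forall x, Z x -> nbhs x (g x)) /\
    (forall x y, Z x -> Z y -> x <> y -> ~ g y x \/ ~ g x y).
Proof.
move=> [f [f_nbhs f_sep]].
(* For [x] in [Z], [g x] agrees with [f x] on [Z] and contains every point outside [Z], which makes
   it a neighbourhood in the whole space. *)
pose g (x : X) : set X := [set w | forall (Zx : x \in Z) (Zw : w \in Z),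
  f (exist _ x Zx) (exist _ w Zw)].
exists g; split=> [x Zx|x y Zx Zy xy].
  have [[U oU fU] fx] := f_nbhs (exist _ x (mem_set Zx)).
  have Ux : U x by move: fx; rewrite -fU.
  apply: filterS (open_nbhs_nbhs (conj oU Ux)) => w Uw Zx' Zw.
  by rewrite (bool_irrelevance Zx' (mem_set Zx)) -fU.
have [|nf|nf] := f_sep (exist _ x (mem_set Zx)) (exist _ y (mem_set Zy)).
- by move=> /(congr1 val).
- by left=> gyx; apply: nf.
- by right=> gxy; apply: nf.
Qed.

(* If [y < z] are in the same piece and closer than its scale, then [y] is in
   every basic neighbourhood of [z], as gaps lie on the right; so weak
   separation forces [z \in J^y], and no point of the piece can be split. *)
Lemma weakly_separated_countable (Z : set X) : generic G ->
  weakly_separated (set_type Z) -> countable Z.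
Proof.
move=> genG /weakly_separated_nbhs[g [g_nbhs g_sep]].
(* The pieces of [Z] with a common scale $1/(k+1)$. *)
pose Zk k := [set x | Z x /\ basic x k.+1%:R^-1 `<=` g x].
apply: (@countable_sub _ _ (\bigcup_k Zk k)).
  move=> x Zx; have [eta /= eta0 etag] := g_nbhs x Zx.
  have [k] := ltr_add_invr eta0; rewrite add0r => keta.
  exists k => //; split=> //; apply: subset_trans etag.
  exact/basic_sub/ltW.
apply: bigcup_countable => // k _; apply: countable_pt.
apply: countable_sub (genG (pt @` Zk k)) => _ [y [Zy yg] <-].
split; first by exists y.
have k0 : 0 < k.+1%:R^-1 :> R by rewrite invr_gt0 ltr0n.
have [] := pselect (splits_at G (pt y) (pt @` Zk k)) => // -[_ split_y].
have [|_ [z [Zz zg] <-] [/andP[yz zy] ngap]] := split_y (pt y + k.+1%:R^-1).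
  by rewrite ltrDl.
have ne : y <> z by move=> E; rewrite E ltxx in yz.
have [[]|[]] := g_sep _ _ Zy Zz ne.
  apply/zg/basicP; split; last by move=> /gap_gt; rewrite ltNge ltW.
  by rewrite ltrBlDr zy (lt_trans yz)// ltrDl.
by apply/yg/basicP; split=> //; rewrite zy andbT (lt_trans _ yz)// ltrBlDr ltrDl.
Qed.

(** This gives the lower bound for $R$: points chosen in the intervals $(2n,2n+1)$ are more than 1
    apart, so Euclidean unit balls separate them. *)
Lemma exists_infinite_weakly_separated :
  exists2 Z : set X, weakly_separated (set_type Z) & ([set: nat] #<= Z)%card.
Proof.
have /choice[x xP] : forall n, exists x : X, n.*2%:R < pt x < n.*2%:R + 1.
  move=> n; have [|r irr rn] := @exists_irrational n.*2%:R (n.*2%:R + 1).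
    by rewrite ltrDl.
  by have [u ur] := exists_pt G irr; exists u; rewrite ur.
have far m n : (m < n)%N -> pt (x m) + 1 < pt (x n).
  move=> mn; have /andP[_ xm] := xP m; have /andP[xn _] := xP n.
  have : m.*2%:R + 1 + 1 <= n.*2%:R :> R.
    by rewrite !natr1 ler_nat -doubleS leq_double.
  lra.
have far' m n : `|pt (x m) - pt (x n)| < 1 -> m = n.
  rewrite ltr_distl => /andP[h1 h2].
  by have [/far ?|/far ?|//] := ltngtP m n; exfalso; lra.
exists (range x).
  exists (fun z : set_type (range x) =>
    set_val @^-1` (pt @^-1` (ball (pt (set_val z)) 1))); split=> [z|y z yz].
    split; last by rewrite /= /ball /= subrr normr0.
    exists (pt @^-1` (ball (pt (set_val z)) 1)) => //.
    by apply: open_comp (ball_open _ _) => // u _; exact: pt_continuous.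
  left=> /=; rewrite /ball /=.
  have [m _ mE] : range x (set_val y) := set_valP y.
  have [n _ nE] : range x (set_val z) := set_valP z.
  by rewrite -mE -nE => /far' nm; apply/yz/val_inj; rewrite /= -[LHS]mE -[RHS]nE nm.
have xI : {in [set: nat] &, injective x}.
  by move=> m n _ _ E; apply: far'; rewrite E subrr normr0.
by have := inj_card_eq xI; rewrite card_eq_sym card_eq_le => /andP[].
Qed.

Lemma refined_R : generic G -> is_R X [set: nat].
Proof.
move=> genG; split=> [Z|V L LP]; first exact: weakly_separated_countable.
have [Z wsZ natZ] := exists_infinite_weakly_separated.
exact: card_le_trans natZ (LP Z wsZ).
Qed.

Lemma uncountable_refined : ~ countable [set: X].
Proof.
move=> cX; apply: uncountable_irrational.
apply: countable_sub (sub_countable (card_image_le (@pt _ G) _) cX).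
by move=> r /(exists_pt G)[u ur]; exists u.
Qed.

(** Each [A y] contains [y] and misses its gap, hence is not split at [y]. By genericity, countably
    many values of [A] would account for only countably many points. *)
Lemma uncountable_network (N : set (set X)) : generic G -> network N ->
  forall A : X -> set X, (forall y, [/\ N (A y), A y y & A y `<=` basic y 1]) ->
  ~ countable (range A).
Proof.
move=> genG netN A AP cA; apply: uncountable_refined; apply: countable_pt.
apply: (@countable_sub _ _
  (\bigcup_(B in range A) [set r | (pt @` B) r /\ ~ splits_at G r (pt @` B)])).
  move=> _ [y _ <-]; have [_ Ayy Ay_sub] := AP y.
  exists (A y) => //; split; first by exists y.
  by move=> [[_ [[z Az <-] gz]] _]; have /basicP[_] := Ay_sub z Az; exact.
by apply: bigcup_countable => // B _; exact: genG.
Qed.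

(** Singletons form a network of size $2^\omega$. Conversely, any network contains the range of a
    choice of sets [A y], which is uncountable and no larger than the space, hence of size
    $2^\omega$ by CH. *)
Lemma refined_nw : continuum_hypothesis -> generic G -> is_nw X [set: set nat].
Proof.
move=> CH genG.
have X_le : ([set: X] #<= [set: set nat])%card.
  have /pcard_injP[code codeI] := @sequences_card_le R.
  apply/pcard_injP; exists (fun x => code (cst (pt x))) => x y _ _.
  by move=> /codeI; rewrite !inE => /(_ I I)/(congr1 (fun f => f 0%N))/pt_inj.
split=> [|N netN].
  exists (range (@set1 X)) => [x A [eta eta0 etaA]|].
    exists [set x]; first by split=> //; exists x.
    by apply: subset_trans etaA => _ ->; exact: basic_self.
  have XN : (range (@set1 X) #= [set: X])%card.
    by apply: inj_card_eq => x y _ _ /seteqP[/(_ x erefl)].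
  apply: card_eq_trans XN _; apply: CH_uncountable => //; exact: uncountable_refined.
have /choice[A AP] : forall y, exists A, [/\ N A, A y & A `<=` basic y 1].
  by move=> y; have [A [NA Ay] Asub] := netN y _ (nbhs_basic y ltr01); exists A.
have A_le : (range A #<= [set: set nat])%card.
  exact: card_le_trans (card_image_le _ _) X_le.
have := CH_uncountable CH A_le (uncountable_network genG netN AP).
rewrite card_eq_le => /andP[_ le]; apply: card_le_trans le _.
by apply: subset_card_le => _ [y _ <-]; have [] := AP y.
Qed.

End Invariants.

(** * The refined space of a generic choice of gaps *)

Local Open Scope classical_set_scope.

Theorem theorem3p3 (R : realType) (CH : continuum_hypothesis) :
  exists tau : Topological (set_type (@irrational R)),
    let X : topologicalType := Topological.Pack tau in
    [/\ clopen_based X, first_countable X & standard_refinement tau] /\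
    [/\ is_R X [set: nat],
        is_nw X [set: set nat] &
        exists B : set (set X), irreducible_base B].
Proof.
have [G genG] := @generic_gaps_exist R CH.
exists (Topological.class (refined G)); split.
  split; [exact: refined_clopen_based|exact: refined_first_countable|].
  exact: refined_standard.
split; [exact: refined_R|exact: refined_nw|exact: refined_irreducible_base].
Qed.
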